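(* Let $G$ be a group and let $H$ be a subgroup. Define $\mathcal{I}_H$ to be the collection of all subsets $A$ of $G$ satisfying $$|A\cap gH|\leq 1\qquad\text{for all } g\in G.$$ Then $\mathcal{I}_H$ is an independence structure on $G$. With this structure, $G$ is a modular independence group. Moreover, for every $X\subseteq G$, $$\operatorname{cl}(X)=XH\qquad\text{and}\qquad \rho(X)=|\{xH:x\in X\}|.$$ Consequently, the flats of $G$ are precisely the unions of left cosets of $H$.
   Context: A finitary matroid is a pair $(E,\mathcal{I})$ consisting of a set $E$ and a nonempty collection $\mathcal{I}$ of subsets of $E$ (called the independent sets) such that: (I1) if $A\in\mathcal{I}$ and $B\subseteq A$ then $B\in\mathcal{I}$; (I2) if $A,B$ are finite elements of $\mathcal{I}$ with $|B|=|A|+1$, then there is $x\in B\setminus A$ with $\{x\}\cup A\in\mathcal{I}$; (I3) if $A\subseteq E$ and every finite subset of $A$ belongs to $\mathcal{I}$, then $A\in\mathcal{I}$. The collection $\mathcal{I}$ is called an independence structure on $E$. A basis of a subset $A\subseteq E$ is an inclusion-maximal independent subset of $A$; any two bases of $A$ have the same cardinality, and the rank $\rho(A)$ is that cardinal number. An element $x\in E$ depends on $A\subseteq E$ if either $x\in A$, or $x\notin A$ and $\{x\}\cup B\notin\mathcal{I}$ for some independent $B\subseteq A$. The closure is $\operatorname{cl}(A)=\{x\in E: x\text{ depends on }A\}$, and $A$ is a flat if $\operatorname{cl}(A)=A$. The finitary matroid is modular if $\rho(A)+\rho(B)=\rho(A\cup B)+\rho(A\cap B)$ (as cardinals) for all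 flats $A,B$. An independence group is a group $G$ (written multiplicatively) together with an independence structure $\mathcal{I}$ on the set $G$ such that for every $g\in G$ and $A\subseteq G$ one has $gA\in\mathcal{I}$ if and only if $A\in\mathcal{I}$, where $gA=\{gx:x\in A\}$. A modular independence group is an independence group that is modular as a finitary matroid. For $X,Y\subseteq G$, $XY=\{xy:x\in X,y\in Y\}$. *)

(* Defs.v *)
From mathcomp Require Import all_boot.
From mathcomp Require Import boolp classical_sets functions cardinality.

Set Implicit Arguments.
Unset Strict Implicit.
Unset Printing Implicit Defensive.

Local Open Scope classical_set_scope.
Local Open Scope card_scope.

Section Matroid.
Variable E : Type.
Implicit Types (I : set (set E)) (A B : set E).

(* The second axiom says |A| = n and |B| = n + 1, for some natural number n. *)
Record independence_structure I : Prop := IndependenceStructure {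
  indep_nonempty : I !=set0;
  indep_sub : forall A B, I A -> B `<=` A -> I B;
  indep_exchange : forall (n : nat) A B, I A -> I B ->
    A #= `I_n -> B #= `I_n.+1 -> exists2 x, (B `\` A) x & I (x |` A);
  indep_finitary : forall A,
    (forall B, B `<=` A -> finite_set B -> I B) -> I A
}.

Definition basis I A B : Prop :=
  [/\ B `<=` A, I B & forall C, B `<=` C -> C `<=` A -> I C -> C = B].

(* There is no type of cardinals: a cardinal is represented by any set having
   that cardinality, and equality of cardinals is #=. Thus rank_is I A K means
   rho(A) = |K|; K need not live in E. *)
Definition rank_is I A (U : Type) (K : set U) : Prop :=
  (exists B, basis I A B) /\ (forall B, basis I A B -> B #= K).

Definition depends I x A : Prop :=
  A x \/ ~ A x /\ exists B, [/\ I B, B `<=` A & ~ I (x |` B)].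

Definition cl I A : set E := [set x | depends I x A].

Definition flat I A : Prop := cl I A = A.

End Matroid.

Definition card_sum (T U : Type) (A : set T) (B : set U) : set (T + U) :=
  inl @` A `|` inr @` B.

(* Ranks are cardinalities of subsets of E, so representatives can be taken in
   E; by rank_is_unique below their choice is immaterial. *)
Definition modular (E : Type) (I : set (set E)) : Prop :=
  forall A B : set E, flat I A -> flat I B ->
  exists rA rB rU rI : set E,
    [/\ rank_is I A rA, rank_is I B rB, rank_is I (A `|` B) rU,
        rank_is I (A `&` B) rI & card_sum rA rB #= card_sum rU rI].

Lemma rank_is_unique (E U V : Type) (I : set (set E)) (A : set E)
    (K : set U) (L : set V) : rank_is I A K -> rank_is I A L -> K #= L.
Proof.
move=> [[B bB] hK] [_ hL].
by apply: card_eq_trans (hL _ bB); rewrite card_eq_sym; exact: hK.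
Qed.

Section IndependenceGroup.
Variable G : groupType.
Implicit Types (g : G) (A X Y H : set G) (I : set (set G)).
Local Open Scope group_scope.

Definition lmulset g A : set G := [set g * x | x in A].

Definition mulset X Y : set G := [set x * y | x in X & y in Y].

Definition independence_group I : Prop :=
  independence_structure I /\ forall g A, I (lmulset g A) <-> I A.

Definition modular_independence_group I : Prop :=
  independence_group I /\ modular I.

Definition coset_indep H : set (set G) :=
  [set A | forall g, A `&` lmulset g H #<= `I_1].

End IndependenceGroup.

(* Main.v *)
Require Import Defs.
From mathcomp Require Import all_boot.
From mathcomp Require Import boolp classical_sets functions cardinality.

(** Left cosets of [H] are the fibres of the map [x |-> x H], and a set meets
    every coset in at most one point exactly when this map is injective on it.
    So the structure is an instance of the partition matroid of a map [f]: the
    independent sets are those on which [f] is injective.  Everything about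
    partition matroids is read off from images under [f]:
    - a basis [B] of [X] is a subset of [X] mapped bijectively onto [f @` X],
      whence [rank_is_fibre_indep]: the rank of [X] is the cardinality of
      [f @` X] (bases exist by choosing one point in each fibre);
    - a set of smaller image cannot absorb the image of a larger one, which is
      the exchange axiom;
    - [x] depends on [X] exactly when its fibre meets [X], so the closure is
      saturation and the flats are the saturated sets ([cl_fibre_indep]).
    For modularity ([modular_fibre_indep]), fix one transversal [R] of all the
    fibres.  If [A] and [B] are saturated then so are their union and
    intersection, and intersecting each of the four sets with [R] gives a basis
    of it.  The identity between ranks thus reduces to
    |P| + |Q| = |P u Q| + |P n Q| for arbitrary sets ([card_sum_setUI]), which
    holds for infinite cardinals too because it comes from a bijection.

    What is specific to groups is only that [x H = y H] means [x^-1 y \in H],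
    a relation invariant under left translation. *)

Set Implicit Arguments.
Unset Strict Implicit.
Unset Printing Implicit Defensive.

Local Open Scope classical_set_scope.
Local Open Scope card_scope.

(** * Cardinality *)

Lemma card_le1P (T : Type) (A : set T) : A #<= `I_1 <-> is_subset1 A.
Proof.
split=> [/pcard_leP[g] x y Ax Ay|A1].
  have to0 z : A z -> g z = 0%N.
    by move=> Az; have := 'funS_g Az; rewrite /= ltnS leqn0 => /eqP.
  have g_inj : {in A &, injective g} by exact: 'inj_g.
  by apply: (g_inj x y (mem_set Ax) (mem_set Ay)); rewrite !to0.
have inj0 : {in A &, injective (fun _ : T => 0%N)}.
  by move=> x y; rewrite !inE => Ax Ay _; exact: A1.
rewrite -(card_le_eql (inj_card_eq inj0)).
by apply: subset_card_le => _ [x _ <-].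
Qed.

(** The elements of [Q] outside [P] are moved to the first summand; those in
    [P `&` Q] stay in the second one. *)
Lemma card_sum_setUI (T : Type) (P Q : set T) :
  Defs.card_sum P Q #= Defs.card_sum (P `|` Q) (P `&` Q).
Proof.
pose phi (u : T + T) : T + T :=
  match u with
  | inl x => inl x
  | inr x => if pselect (P x) then inr x else inl x
  end.
have phi_inj : {in Defs.card_sum P Q &, injective phi}.
  move=> u v; rewrite !inE => -[[x Px <-]|[x Qx <-]] [[y Py <-]|[y Qy <-]] //=;
    by do ?[case: pselect => ? //=]; case=> ?; subst.
rewrite -(card_eql (inj_card_eq phi_inj)).
suff -> : phi @` Defs.card_sum P Q = Defs.card_sum (P `|` Q) (P `&` Q).
  exact: card_eqxx.
apply/seteqP; split=> [_ [_ [[x Px <-]|[x Qx <-]] <-]|_ [[x PQx <-]|[x [Px Qx] <-]]].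
- by left; exists x => //; left.
- rewrite /=; case: pselect => Px; first by right; exists x.
  by left; exists x => //; right.
- have [Px|nPx] := pselect (P x); first by exists (inl x) => //; left; exists x.
  case: PQx => // Qx; exists (inr x); first by right; exists x.
  by rewrite /=; case: pselect.
- exists (inr x); first by right; exists x.
  by rewrite /=; case: pselect.
Qed.

(** * The partition matroid of a map *)

Definition fibre_indep (E T : Type) (f : E -> T) : set (set E) :=
  [set A | forall x y, A x -> A y -> f x = f y -> x = y].

Definition saturated (E T : Type) (f : E -> T) (A : set E) : Prop :=
  forall x y, A x -> f x = f y -> A y.

Lemma card_fibre_indep (E T : Type) (f : E -> T) (A : set E) :
  fibre_indep f A -> f @` A #= A.
Proof.
by move=> fA; apply: inj_card_eq => x y; rewrite !inE; exact: fA.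
Qed.

Lemma fibre_indepU1 (E T : Type) (f : E -> T) (A : set E) (x : E) :
  fibre_indep f A -> ~ (f @` A) (f x) -> fibre_indep f (x |` A).
Proof.
move=> fA fx y z [->|Ay] [->|Az] //; last exact: fA.
- by move=> e; case: fx; exists z.
- by move=> e; case: fx; exists y.
Qed.

Lemma fibre_indep_structure (E T : Type) (f : E -> T) :
  independence_structure (fibre_indep f).
Proof.
split.
- by exists set0.
- by move=> A B fA BA x y /BA Ax /BA Ay; exact: fA.
- move=> n A B fA fB An Bn.
  have [y By fy] : exists2 y, B y & ~ (f @` A) (f y).
    (* Otherwise [f] would send [n.+1] points injectively into [n] values. *)
    apply: contrapT => noy.
    suff : `I_n.+1 #<= `I_n by rewrite card_le_II ltnn.
    rewrite -(card_le_eql Bn) -(card_le_eqr An).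
    rewrite -(card_le_eql (card_fibre_indep fB)).
    rewrite -(card_le_eqr (card_fibre_indep fA)).
    apply: subset_card_le => _ [y By <-].
    by apply: contrapT => fy; apply: noy; exists y.
  exists y; last exact: fibre_indepU1.
  by split=> // Ay; apply: fy; exists y.
- move=> A finA x y Ax Ay.
  (* A failure of injectivity on [A] already shows on a pair. *)
  by apply: (finA [set x; y]) => [_ [->|->] //||/=|/=]; [|left|right].
Qed.

Lemma image_basis_fibre_indep (E T : Type) (f : E -> T) (X B : set E) :
  basis (fibre_indep f) X B -> f @` B = f @` X.
Proof.
case=> BX fB maxB; apply/seteqP; split; first exact: image_subset.
move=> _ [x Xx <-]; apply: contrapT => fx; apply: (fx).
exists x => //; rewrite -(maxB (x |` B)); first by left.
- by move=> y By; right.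
- by move=> y [->|/BX].
- exact: fibre_indepU1.
Qed.

Lemma basis_fibre_indep (E T : Type) (f : E -> T) (X B : set E) :
  B `<=` X -> fibre_indep f B -> f @` X `<=` f @` B ->
  basis (fibre_indep f) X B.
Proof.
move=> BX fB XB; split=> // C BC CX fC; apply/seteqP; split=> // x Cx.
have [y By fyx] : (f @` B) (f x) by apply: XB; exists x => //; exact: CX.
by rewrite -(fC y x (BC _ By) Cx fyx).
Qed.

(** Choosing on the type of points of [f @` X], rather than on all of [T], spares
    the need for a default value in [E]. *)
Lemma exists_transversal (E T : Type) (f : E -> T) (X : set E) :
  exists B, [/\ B `<=` X, fibre_indep f B & f @` X `<=` f @` B].
Proof.
have /choice[s sP] : forall t : {t : T | (f @` X) t},
    exists x, X x /\ f x = sval t.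
  by case=> t /= [x Xx fxt]; exists x.
exists (range s); split.
- by move=> _ [t _ <-]; case: (sP t).
- move=> _ _ [t _ <-] [u _ <-]; rewrite (sP t).2 (sP u).2.
  by move=> /eq_sig_hprop-> // v p q; exact: Prop_irrelevance.
- move=> t Xt; exists (s (exist _ t Xt)); first by exists (exist _ t Xt).
  by rewrite (sP _).2.
Qed.

Lemma rank_is_fibre_indep (E T : Type) (f : E -> T) (X : set E) :
  rank_is (fibre_indep f) X (f @` X).
Proof.
split.
  have [B [BX fB XB]] := exists_transversal f X.
  by exists B; exact: basis_fibre_indep.
move=> B bB; rewrite -(image_basis_fibre_indep bB).
by case: bB => _ fB _; apply: card_esym; exact: card_fibre_indep.
Qed.

Lemma rank_is_basis_fibre_indep (E T : Type) (f : E -> T) (X B : set E) :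
  basis (fibre_indep f) X B -> rank_is (fibre_indep f) X B.
Proof.
move=> bB; have [exX rX] := rank_is_fibre_indep f X; split=> // C bC.
exact: card_eq_trans (rX _ bC) (card_esym (rX _ bB)).
Qed.

(** A point [y] of [X] in the fibre of [x] witnesses the dependence through the
    independent set [[set y]]; without such a point [x] can be added to any
    independent subset of [X]. *)
Lemma cl_fibre_indep (E T : Type) (f : E -> T) (X : set E) :
  cl (fibre_indep f) X = f @^-1` (f @` X).
Proof.
apply/seteqP; split=> [x [Xx|[_ [B [fB BX nfB]]]]|x [y Xy fyx]].
- by exists x.
- apply: contrapT => fx; apply: nfB; apply: fibre_indepU1 => //.
  by case=> y /BX Xy fyx; apply: fx; exists y.
- have [Xx|nXx] := pselect (X x); [by left|right; split=> //].
  exists [set y]; split=> [_ _ -> -> //|_ -> //|fxy].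
  by apply: nXx; rewrite (fxy x y)//; [left|right].
Qed.

Lemma flat_fibre_indep (E T : Type) (f : E -> T) (X : set E) :
  flat (fibre_indep f) X <-> saturated f X.
Proof.
rewrite /flat cl_fibre_indep; split=> [clX x y Xx fxy|satX].
  by rewrite -clX; exists x.
apply/seteqP; split=> [x [y Xy fyx]|x Xx]; first exact: satX fyx.
by exists x.
Qed.

Lemma basis_saturated (E T : Type) (f : E -> T) (R A : set E) :
  fibre_indep f R -> f @` setT `<=` f @` R -> saturated f A ->
  basis (fibre_indep f) A (A `&` R).
Proof.
move=> fR fullR satA; apply: basis_fibre_indep.
- exact: subIsetl.
- by move=> x y [_ Rx] [_ Ry]; exact: fR.
- move=> _ [x Ax <-].
  have [y Ry fyx] : (f @` R) (f x) by apply: fullR; exists x.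
  by exists y => //; split=> //; exact: satA (esym fyx).
Qed.

Lemma modular_fibre_indep (E T : Type) (f : E -> T) : modular (fibre_indep f).
Proof.
move=> A B /flat_fibre_indep satA /flat_fibre_indep satB.
have [R [_ fR fullR]] := exists_transversal f setT.
have rankR C : saturated f C -> rank_is (fibre_indep f) C (C `&` R).
  by move=> satC; apply: rank_is_basis_fibre_indep; exact: basis_saturated.
exists (A `&` R), (B `&` R), ((A `|` B) `&` R), ((A `&` B) `&` R).
split; try apply: rankR => //.
- by move=> x y [Ax|Bx] fxy; [left; exact: satA fxy|right; exact: satB fxy].
- by move=> x y [Ax Bx] fxy; split; [exact: satA fxy|exact: satB fxy].
- by rewrite setIUl setIIl; exact: card_sum_setUI.
Qed.

(** * Cosets *)

Local Open Scope group_scope.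

Lemma lmulsetE (G : groupType) (g x : G) (A : set G) :
  lmulset g A x <-> A (g^-1 * x).
Proof.
split=> [[a Aa <-]|Agx]; first by rewrite mulKg.
by exists (g^-1 * x) => //; rewrite mulVKg.
Qed.

Lemma lmulset_eq (G : groupType) (H : groupClosed G) (x y : G) :
  lmulset x [set` H] = lmulset y [set` H] <-> lmulset x [set` H] y.
Proof.
split=> [->|/lmulsetE /= Hxy].
  by apply/lmulsetE; rewrite /= mulVg; exact: gpred1.
apply/seteqP; split=> z /lmulsetE /= Hz; apply/lmulsetE => /=.
  by rewrite -(mulVKg x z) mulgA gpredMl// -gpredV invgM invgK.
by rewrite -(mulVKg y z) mulgA gpredMl.
Qed.

Lemma coset_indepE (G : groupType) (H : groupClosed G) :
  coset_indep [set` H] = fibre_indep (fun x => lmulset x [set` H]).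
Proof.
apply/seteqP; split=> A IA.
  move=> x y Ax Ay /lmulset_eq xHy; have /card_le1P := IA x; apply; split=> //.
  by apply/lmulset_eq.
move=> g; apply/card_le1P => x y [Ax /lmulset_eq gHx] [Ay /lmulset_eq gHy].
by apply: IA => //; rewrite -gHx -gHy.
Qed.

Lemma coset_indep_lmulset (G : groupType) (H : groupClosed G) (g : G)
    (A : set G) :
  coset_indep [set` H] (lmulset g A) <-> coset_indep [set` H] A.
Proof.
have gcosets x y : lmulset (g * x) [set` H] = lmulset (g * y) [set` H] <->
    lmulset x [set` H] = lmulset y [set` H].
  by rewrite !lmulset_eq !lmulsetE /= invgM -mulgA mulKg.
rewrite coset_indepE; split=> [IgA x y Ax Ay xHy|IA _ _ [x Ax <-] [y Ay <-]].
  by apply: (mulgI g); apply: IgA; [exists x|exists y|apply/gcosets].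
by move=> /gcosets xHy; rewrite (IA x y).
Qed.

Lemma cl_coset_indep (G : groupType) (H : groupClosed G) (X : set G) :
  cl (coset_indep [set` H]) X = mulset X [set` H].
Proof.
rewrite coset_indepE cl_fibre_indep; apply/seteqP; split=> y.
  by case=> x Xx /lmulset_eq[h Hh <-]; exists x => //; exists h.
case=> x Xx [h Hh <-]; exists x => //; apply/lmulset_eq.
by exists h.
Qed.

Lemma flat_coset_indep (G : groupType) (H : groupClosed G) (F : set G) :
  flat (coset_indep [set` H]) F <->
  exists S : set G, F = \bigcup_(g in S) lmulset g [set` H].
Proof.
split=> [flatF|[S ->]].
  exists F; rewrite -{1}flatF cl_coset_indep; apply/seteqP; split=> y.
    by case=> x Fx [h Hh <-]; exists x => //; exists h.
  by case=> x Fx [h Hh <-]; exists x => //; exists h.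
rewrite coset_indepE; apply/flat_fibre_indep => x y [g Sg /lmulset_eq gHx] xHy.
by exists g => //; apply/lmulset_eq; rewrite gHx.
Qed.

Theorem proposition5p10 (G : groupType) (H : groupClosed G) :
  let IH := coset_indep [set` H] in
  [/\ independence_structure IH,
      modular_independence_group IH,
      forall X : set G, cl IH X = mulset X [set` H],
      forall X : set G,
        rank_is IH X [set lmulset x [set` H] | x in X]
    & forall F : set G, flat IH F <->
        exists S : set G, F = \bigcup_(g in S) lmulset g [set` H]].
Proof.
move=> IH.
have indep_IH : independence_structure IH.
  by rewrite /IH coset_indepE; exact: fibre_indep_structure.
split=> //.
- split; first by split=> // g A; exact: coset_indep_lmulset.
  by rewrite /IH coset_indepE; exact: modular_fibre_indep.
- exact: cl_coset_indep.
- by move=> X; rewrite /IH coset_indepE; exact: rank_is_fibre_indep.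
- exact: flat_coset_indep.
Qed.
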